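(* Let $n\ge 4$ and let $BS_n$ be the $n$-dimensional bubble-sort star graph. Then $BS_n$ is $(6n-17)$-conditional edge-fault-tolerant strongly Menger edge connected, i.e., for every $F_e\subseteq E(BS_n)$ with $|F_e|\le 6n-17$ and $\delta(BS_n-F_e)\ge 2$, the graph $BS_n-F_e$ is strongly Menger edge connected. Moreover, the bound $6n-17$ is sharp: there exists $F_e\subseteq E(BS_n)$ with $|F_e|=6n-16$ and $\delta(BS_n-F_e)\ge2$ such that $BS_n-F_e$ is not strongly Menger edge connected.
   Context: The $n$-dimensional bubble-sort star graph $BS_n$ has as vertex set all permutations $x=x_1x_2\cdots x_n$ of $\{1,\dots,n\}$. Two distinct vertices $x,y$ are adjacent iff there is $k\in\{2,\dots,n\}$ such that $y$ is obtained from $x$ either by swapping the entries in positions $k-1$ and $k$, or by swapping the entries in positions $1$ and $k$. ($BS_n$ is bipartite and $(2n-3)$-regular with $n!$ vertices.) For $F_e\subseteq E(G)$, $G-F_e$ is the graph with vertex set $V(G)$ and edge set $E(G)\setminus F_e$; $\delta(\cdot)$ denotes minimum degree. A graph $G$ is strongly Menger edge connected if for any two distinct vertices $u,v$ of $G$ there exist $\min\{d_G(u),d_G(v)\}$ pairwise edge-disjoint $(u,v)$-paths in $G$. For an integer $m\ge1$, $G$ is $m$-conditional edge-fault-tolerant strongly Menger edge connected if $G-F_e$ is strongly Menger edge connected for every $F_e\subseteq E(G)$ with $|F_e|\le m$ and $\delta(G-F_e)\ge 2$. *)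

(* Defs.v *)
From mathcomp Require Import all_boot all_fingroup.

Set Implicit Arguments.
Unset Strict Implicit.
Unset Printing Implicit Defensive.

Record sgraph := SGraph {
  vertex :> finType;
  adj : rel vertex;
  adj_sym : symmetric adj;
  adj_irrefl : irreflexive adj
}.

(* An edge is the two-element set of its endpoints. *)
Definition edges (G : sgraph) : {set {set G}} :=
  [set [set z.1; z.2] | z : G * G & adj z.1 z.2].

Definition deg (G : sgraph) (x : G) : nat := #|[set y | adj x y]|.

(* A degree is less than #|G|, so the default value #|G| never affects the
   minimum when G has a vertex. *)
Definition min_deg (G : sgraph) : nat := \big[minn/#|G|]_(x : G) deg x.

Section DeleteEdges.
Variables (G : sgraph) (F : {set {set G}}).

Definition del_adj : rel G := fun x y => adj x y && ([set x; y] \notin F).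

Lemma del_adj_sym : symmetric del_adj.
Proof. by move=> x y; rewrite /del_adj adj_sym setUC. Qed.

Lemma del_adj_irrefl : irreflexive del_adj.
Proof. by move=> x; rewrite /del_adj adj_irrefl. Qed.

Definition del_edges : sgraph := SGraph del_adj_sym del_adj_irrefl.

End DeleteEdges.

(* The vertex sequence of the path is u :: p. *)
Definition is_path (G : sgraph) (u v : G) (p : seq G) : bool :=
  [&& path (@adj G) u p, last u p == v & uniq (u :: p)].

Definition path_edges (G : sgraph) (u : G) (p : seq G) : {set {set G}} :=
  [set [set z.1; z.2] | z in zip (u :: p) p].

Definition strongly_Menger_edge_connected (G : sgraph) : Prop :=
  forall u v : G, u != v ->
    exists ps : 'I_(minn (deg u) (deg v)) -> seq G,
      (forall i, is_path u v (ps i)) /\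
      (forall i j, i != j ->
         [disjoint path_edges u (ps i) & path_edges u (ps j)]).

Definition conditional_edge_fault_tolerant_SMEC (m : nat) (G : sgraph) : Prop :=
  forall F : {set {set G}}, F \subset edges G -> #|F| <= m ->
    2 <= min_deg (del_edges F) ->
    strongly_Menger_edge_connected (del_edges F).

Section BubbleSortStar.
Variable n : nat.

(* Positions and entries are numbered from 0, and x i is the entry of x at
   position i.  Since (s * x) i = x (s i) for permutations, tperm i k * x is x
   with the entries in positions i and k swapped. *)
Definition bs_adj : rel {perm 'I_n} := fun x y =>
  [exists i : 'I_n, exists k : 'I_n,
    [&& 0 < k, (i == k.-1 :> nat) || (i == 0 :> nat)
      & y == (tperm i k * x)%g]].

Lemma bs_adj_sym : symmetric bs_adj.
Proof.
suff S x y : bs_adj x y -> bs_adj y x by move=> x y; apply/idP/idP => /S.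
case/existsP=> i /existsP[k /and3P[k0 ik /eqP ->]].
apply/existsP; exists i; apply/existsP; exists k.
by rewrite k0 ik mulgA tperm2 mul1g eqxx.
Qed.

Lemma bs_adj_irrefl : irreflexive bs_adj.
Proof.
move=> x; apply/negbTE/negP=> /existsP[i /existsP[k /and3P[k0 ik /eqP ex]]].
have /perm_inj eik : x i = x k by rewrite {1}ex permM tpermL.
by move: k0 ik; rewrite eik; case: (nat_of_ord k) => // m _; rewrite gtn_eqF.
Qed.

Definition BS : sgraph := SGraph bs_adj_sym bs_adj_irrefl.

End BubbleSortStar.

(* Main.v *)
Require Import Defs.
From mathcomp Require Import all_boot all_fingroup.
From mathcomp Require Import all_order all_algebra zify.

Set Implicit Arguments.
Unset Strict Implicit.
Unset Printing Implicit Defensive.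

(* Write r = 2n - 3 for the degree of BS_n.  By Menger's theorem it suffices to
   bound the cuts of BS_n - F that separate u from v.  If both sides of a cut
   have at least 4 vertices, BS_n itself has at least 4r - 8 = 8n - 20 edges
   across it, so at least 2n - 3 survive the deletion of 6n - 17 edges; if one
   side has at most 3 vertices, it spans at most 2 edges and the condition on the
   minimum degree alone gives as many surviving edges as the degree of u or v.

   The bound 8n - 20 is proved by induction on n, cutting BS_n into n copies of
   BS_(n-1) ("layers") according to the last entry.  Every layer met by both
   sides contributes at least 2n - 5 edges, so four such layers are enough, and
   otherwise some layer lies entirely on one side and the edges between the
   layers make up the difference.

   The bound is attained around a 4-cycle: all but one of the 6n - 15 edges which
   leave it from the three vertices other than u are deleted, so that only 2n - 4
   edges still leave the 4-cycle while u keeps its degree 2n - 3. *)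

(** * The edge version of Menger's theorem *)

Lemma set2_inj (T : finType) (x y a b : T) :
  [set x; y] = [set a; b] -> (x, y) = (a, b) \/ (x, y) = (b, a).
Proof.
move=> eq_xy; have : y \in [set a; b] by rewrite -eq_xy set22.
have : x \in [set a; b] by rewrite -eq_xy set21.
have : b \in [set x; y] by rewrite eq_xy set22.
have : a \in [set x; y] by rewrite eq_xy set21.
do 4![case/set2P=> ?]; subst; auto.
Qed.

Section Flows.
Import Order.TTheory GRing.Theory Num.Theory.
Local Open Scope ring_scope.

Lemma path_zip (T : Type) (e : rel T) (a : T) (p : seq T) :
  path e a p = all (fun z => e z.1 z.2) (zip (a :: p) p).
Proof. by elim: p a => //= b p IHp a; rewrite IHp. Qed.

Lemma zip_consecutive_mem (T : eqType) (a : T) (p : seq T) (x y : T) :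
  (x, y) \in zip (a :: p) p -> (x \in a :: p) && (y \in a :: p).
Proof.
elim: p a => //= b p IHp a; rewrite !inE => /orP[/eqP[-> ->]|/IHp].
  by rewrite !eqxx orbT.
by rewrite !inE => /andP[-> ->]; rewrite !orbT.
Qed.

Variable (G : sgraph).
Implicit Types (x y u v : G) (p : seq G) (f : G -> G -> int).

(** Net number of passages of the walk [u :: p] from [x] to [y]. Counting reversed passages
    negatively lets an augmenting path cancel flow that runs against it. *)
Fixpoint unit_flow u p x y : int :=
  if p is b :: q then
    ((x == u) && (y == b))%:Z - ((y == u) && (x == b))%:Z + unit_flow b q x y
  else 0.

Lemma unit_flow_anti u p x y : unit_flow u p x y = - unit_flow u p y x.
Proof. elim: p u => //= b p IHp u; rewrite {}IHp; lia. Qed.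

Lemma sum_indicator (P : pred G) x : \sum_y (P y && (y == x))%:Z = (P x)%:Z.
Proof.
rewrite (bigD1 x) //= eqxx andbT big1 ?addr0 // => y /negPf ->.
by rewrite andbF.
Qed.

Lemma unit_flow_div u p x :
  \sum_y unit_flow u p x y = (x == u)%:Z - (x == last u p)%:Z.
Proof.
elim: p u => [|b p IHp] u /=; first by rewrite big1 // subrr.
rewrite big_split big_split /= IHp sumrN (sum_indicator (fun=> x == u)).
under [X in _ - X]eq_bigr => y _ do rewrite andbC.
rewrite (sum_indicator (fun=> x == b)); lia.
Qed.

Lemma unit_flowE u p x y : uniq (u :: p) ->
  unit_flow u p x y =
    ((x, y) \in zip (u :: p) p)%:Z - ((y, x) \in zip (u :: p) p)%:Z.
Proof.
elim: p u => //= b p IHp u /andP[u_notin uniq_bp].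
rewrite IHp // !inE !xpair_eqE.
have notin z : (u, z) \notin zip (b :: p) p.
  by apply: contra u_notin => /zip_consecutive_mem/andP[].
case: (x =P u) => [->|_]; case: (y =P u) => [->|_] /=;
  rewrite ?(negPf (notin _)) ?orbF; try lia.
Qed.

(* An undirected integral flow: f x y = - f y x is the net flow from x to y. *)
Definition flow u v f (k : nat) : Prop :=
  [/\ forall x y, f x y = - f y x,
      forall x y, f x y <= (adj x y)%:Z
    & forall x, \sum_y f x y = ((x == u) * k)%:Z - ((x == v) * k)%:Z].

(** Antisymmetry cancels the flow inside [A], so the flow out of [A] is the total divergence over
    [A], to which only [u] contributes. *)
Lemma flow_cut u v f k (A : {set G}) : flow u v f k -> u \in A -> v \notin A ->
  \sum_(x in A) \sum_(y in ~: A) f x y = k%:Z.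
Proof.
case=> anti _ div uA vA.
have inner : \sum_(x in A) \sum_(y in A) f x y = 0.
  suff : \sum_(x in A) \sum_(y in A) f x y = - \sum_(x in A) \sum_(y in A) f x y.
    lia.
  rewrite {1}exchange_big /= -sumrN; apply: eq_bigr => x _.
  by rewrite -sumrN; apply: eq_bigr => y _.
rewrite -[LHS]add0r -{1}inner -big_split /=.
transitivity (\sum_(x in A) \sum_y f x y).
  apply: eq_bigr => x _; rewrite [RHS](bigID (mem A)) /=.
  by congr (_ + _); apply: eq_bigl => y; rewrite inE.
rewrite (bigD1 u) //= div big1 => [|x /andP[xA /negPf xu]].
  by rewrite eqxx; case: (u =P v) vA uA => [-> /negP//|_] _ _; lia.
by rewrite div xu; case: (x =P v) xA vA => [-> ->|] //.
Qed.

Lemma simple_path u v (e : rel G) : u != v ->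
  (forall A : {set G}, u \in A -> v \notin A ->
     [exists x in A, exists y in ~: A, e x y]) ->
  exists p, [/\ path e u p, last u p = v & uniq (u :: p)].
Proof.
move=> uv leave; have [/connectP[p ep ->]|nconn] := boolP (connect e u v).
  by case/shortenP: ep => q eq uq _; exists q.
pose A := [set x | connect e u x].
have /exists_inP[x + /exists_inP[y]] : [exists x in A, exists y in ~: A, e x y].
  by apply: leave; rewrite inE.
rewrite !inE => ux /negP uy exy; case: uy.
exact: connect_trans ux (connect1 exy).
Qed.

(** Ford-Fulkerson induction: the value grows by one along a simple path of residual pairs, those
    with [f x y < adj x y]. *)
Lemma max_flow u v k : u != v ->
  (forall A : {set G}, u \in A -> v \notin A ->
     (k <= \sum_(x in A) \sum_(y in ~: A) adj x y)%N) ->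
  exists f, flow u v f k.
Proof.
move=> uv; elim: k => [|k IHk] large.
  exists (fun _ _ => 0); split=> [x y|x y|x]; rewrite ?oppr0 //.
  by rewrite big1 // !muln0.
have [|f Ff] := IHk; first by move=> A uA vA; apply: ltnW; apply: large.
have [anti cap div] := Ff.
have [A uA vA|p [ep lp Up]] :=
    @simple_path u v (fun x y => f x y < (adj x y)%:Z) uv.
  (* Without a residual path some cut is saturated, so its capacity is the flow value [k], whereas
     [large] provides at least [k.+1]. *)
  apply: contraT => /exists_inPn full.
  have saturated : \sum_(x in A) \sum_(y in ~: A) f x y =
      (\sum_(x in A) \sum_(y in ~: A) adj x y)%N%:R.
    rewrite natr_sum; apply: eq_bigr => x xA; rewrite natr_sum.
    apply: eq_bigr => y yA; rewrite natz; apply/eqP; rewrite eq_le cap leNgt.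
    by apply/negP => lt; case/exists_inP: (full x xA); exists y.
  have := flow_cut Ff uA vA; have := large A uA vA.
  by rewrite saturated natz; lia.
exists (fun x y => f x y + unit_flow u p x y); split=> [x y|x y|x].
- by rewrite anti unit_flow_anti opprD.
- rewrite unit_flowE //; have := cap x y.
  move: ep; rewrite path_zip => /allP/(_ (x, y)) /=.
  by case: ((x, y) \in _) => [/(_ isT)|_]; lia.
- by rewrite big_split /= div unit_flow_div lp; lia.
Qed.

(** Paths of positive flow are peeled off one at a time; positivity along each path is kept in the
    conclusion because disjointness is deduced from it. *)
Lemma flow_paths u v k f : u != v -> flow u v f k ->
  exists ps : 'I_k -> seq G,
    [/\ forall i, is_path u v (ps i),
        forall i, all (fun z => 0 < f z.1 z.2) (zip (u :: ps i) (ps i))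
      & forall i j, i != j ->
          [disjoint path_edges u (ps i) & path_edges u (ps j)]].
Proof.
move=> uv; elim: k f => [|k IHk] f Ff.
  by exists (fun _ => [::]); split=> [[]|[]|[]].
have [anti cap div] := Ff.
have [A uA vA|p [ep lp Up]] := @simple_path u v (fun x y => 0 < f x y) uv.
  apply: contraT => /exists_inPn full.
  have : \sum_(x in A) \sum_(y in ~: A) f x y <= 0.
    apply: sumr_le0 => x xA; apply: sumr_le0 => y yA; rewrite leNgt.
    by apply/negP => lt; case/exists_inP: (full x xA); exists y.
  by rewrite (flow_cut Ff uA vA).
have pos_p x y : (x, y) \in zip (u :: p) p -> 0 < f x y.
  by move: ep; rewrite path_zip => /allP ep /ep.
pose g x y := f x y - unit_flow u p x y.
have gE x y : g x y = f x y - ((x, y) \in zip (u :: p) p)%:Z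
                            + ((y, x) \in zip (u :: p) p)%:Z.
  by rewrite /g unit_flowE // opprB addrCA addrC.
have capb x y : f x y <= 1 by apply: le_trans (cap x y) _; case: adj.
(* Capacities are 1, so subtracting [p] leaves flow 0 in both directions on each of its edges; paths
   of positive [g] therefore avoid them. *)
have g_pos x y : 0 < g x y ->
    [/\ 0 < f x y, (x, y) \notin zip (u :: p) p & (y, x) \notin zip (u :: p) p].
  rewrite gE; have := anti x y; have := capb x y; have := capb y x.
  case: ((x, y) \in _) (pos_p x y) => [/(_ isT)|_];
    case: ((y, x) \in _) (pos_p y x) => [/(_ isT)|_] *; split=> //; lia.
have [|ps [ps_path ps_pos ps_disj]] := IHk g.
  split=> [x y|x y|x]; rewrite /g.
  - by rewrite anti unit_flow_anti opprD.
  - rewrite -/(g x y); have [/g_pos[_ nxy nyx]|] := ltP 0 (g x y); last first.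
      by move/le_trans; apply.
    by rewrite gE (negPf nxy) (negPf nyx) subr0 addr0.
  - by rewrite sumrB div unit_flow_div lp; lia.
have disj_p i : [disjoint path_edges u p & path_edges u (ps i)].
  rewrite disjoint_subset; apply/subsetP => _ /imsetP[[x y] xyp ->].
  rewrite inE; apply/negP => /imsetP[[a b] /(allP (ps_pos i))/= /g_pos[_ nab nba]].
  by case/set2_inj=> -[ex ey]; move: nab nba; rewrite -ex -ey xyp.
exists (fun i => if unlift ord0 i is Some j then ps j else p).
split=> [i|i|i j].
- case: unliftP => // _; rewrite /is_path lp eqxx Up !andbT.
  apply: sub_path ep => x y /lt_le_trans/(_ (cap x y)); by case: adj.
- case: unliftP => [j _|_]; last by move: ep; rewrite path_zip.
  by apply: sub_all (ps_pos j) => z /g_pos[].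
- case: unliftP => [i' ->|->]; case: unliftP => [j' ->|->] //.
  + by rewrite (inj_eq lift_inj); apply: ps_disj.
  + by rewrite disjoint_sym.
Qed.

End Flows.

Lemma edge_Menger (G : sgraph) (u v : G) (k : nat) : u != v ->
  (forall A : {set G}, u \in A -> v \notin A ->
     k <= \sum_(x in A) \sum_(y in ~: A) adj x y) ->
  exists ps : 'I_k -> seq G,
    (forall i, is_path u v (ps i)) /\
    (forall i j, i != j ->
       [disjoint path_edges u (ps i) & path_edges u (ps j)]).
Proof.
move=> uv /(max_flow uv)[f /(flow_paths uv)[ps [ps_path _ ps_disj]]].
by exists ps.
Qed.

(** * Cuts *)

Lemma sum_card_pred (T : finType) (A : {set T}) (P : pred T) :
  \sum_(x in A) (P x : nat) = #|[set x in A | P x]|.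
Proof.
rewrite -sum1_card (big_mkcond (mem A)) /= [RHS]big_mkcond /=.
by apply: eq_bigr => x _; rewrite !inE; case: (x \in A); case: (P x).
Qed.

Section Arcs.
Variable G : sgraph.
Implicit Types (A B C : {set G}) (x y u v : G).

(* Ordered pairs, so arcs A A is twice the number of edges inside A. *)
Definition arcs A B : nat := \sum_(x in A) \sum_(y in B) adj x y.

Lemma arcsC A B : arcs A B = arcs B A.
Proof.
rewrite /arcs exchange_big; apply: eq_bigr => y _; apply: eq_bigr => x _.
by rewrite adj_sym.
Qed.

Lemma arcs_card A B : arcs A B = #|[set z in setX A B | adj z.1 z.2]|.
Proof.
rewrite /arcs pair_big -sum_card_pred /=.
by apply: eq_bigl => -[x y]; rewrite !inE.
Qed.

Lemma degE x : deg x = \sum_y adj x y.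
Proof.
rewrite /deg -sum1_card big_mkcond; apply: eq_bigr => y _.
by rewrite inE; case: adj.
Qed.

Lemma arcs_splitr A B C : arcs A B = arcs A (B :&: C) + arcs A (B :\: C).
Proof. by rewrite -big_split; apply: eq_bigr => x _; apply: big_setID. Qed.

Lemma arcs_splitl A B C : arcs A B = arcs (A :&: C) B + arcs (A :\: C) B.
Proof. exact: big_setID. Qed.

Lemma arcs_deg A : arcs A (~: A) + arcs A A = \sum_(x in A) deg x.
Proof.
rewrite -big_split; apply: eq_bigr => x _; rewrite degE [RHS](bigID (mem A)) /= addnC.
by congr (_ + _); apply: eq_bigl => y; rewrite inE.
Qed.

Lemma arcs_le_prod A B : arcs A B <= #|A| * #|B|.
Proof.
rewrite -sum_nat_const; apply: leq_sum => x _; rewrite -[#|B|]muln1 -sum_nat_const.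
by apply: leq_sum => y _; case: adj.
Qed.

Definition proper_2coloring (c : pred G) : Prop :=
  forall x y, adj x y -> c x != c y.

Lemma arcs_2coloring c A : proper_2coloring c ->
  arcs A A <= 2 * (#|[set x in A | c x]| * #|[set x in A | ~~ c x]|).
Proof.
move=> col; pose C := [set x | c x].
have mono B : {in B &, forall x y, c x = c y} -> arcs B B = 0.
  move=> eqc; rewrite /arcs big1 // => x xB; rewrite big1 // => y yB.
  by apply/eqP; rewrite eqb0; apply: contraL (eqxx (c x)) => /col; rewrite (eqc x y).
have -> : [set x in A | c x] = A :&: C by apply/setP => x; rewrite !inE.
have -> : [set x in A | ~~ c x] = A :\: C by apply/setP => x; rewrite !inE andbC.
rewrite (arcs_splitl A A C) !(arcs_splitr _ A C) (mono (A :&: C)); last first.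
  by move=> x y; rewrite !inE => /andP[_ ->] /andP[_ ->].
rewrite (mono (A :\: C)); last first.
  by move=> x y; rewrite !inE => /andP[/negPf-> _] /andP[/negPf-> _].
by rewrite (arcsC (A :\: C)) addn0 add0n addnn -mul2n leq_mul2l arcs_le_prod.
Qed.

(** Colour classes of sizes a and b with 1 <= a + b <= 3 satisfy ab <= a + b - 1: such a set spans
    no more edges than a tree. *)
Lemma small_arcs c A : proper_2coloring c -> 0 < #|A| <= 3 ->
  arcs A A + 2 <= 2 * #|A|.
Proof.
move=> /arcs_2coloring col; have := col A.
have -> : #|A| = #|[set x in A | c x]| + #|[set x in A | ~~ c x]|.
  rewrite -(cardsID [set x | c x] A).
  by congr addn; apply: eq_card => x; rewrite !inE // andbC.
move: #|_| #|_| => [|[|[|[|a]]]] [|[|[|[|b]]]] //=; lia.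
Qed.

Lemma sum_deg_small_cut c A : proper_2coloring c -> 0 < #|A| <= 3 ->
  \sum_(x in A) deg x + 2 <= arcs A (~: A) + 2 * #|A|.
Proof. by move=> col /(small_arcs col); rewrite -arcs_deg; lia. Qed.

(* Each vertex of A other than u has degree at least 2, while a set of at most
   three vertices spans at most #|A| - 1 edges. *)
Lemma deg_le_small_cut c A u : proper_2coloring c -> (forall x, 2 <= deg x) ->
  u \in A -> #|A| <= 3 -> deg u <= arcs A (~: A).
Proof.
move=> col deg2 uA A3.
have A0 : 0 < #|A| by apply/card_gt0P; exists u.
have := sum_deg_small_cut col (introT andP (conj A0 A3)).
rewrite (bigD1 u) //= => le.
have : 2 * #|A :\ u| <= \sum_(i in A | i != u) deg i.
  rewrite mulnC -sum_nat_const (eq_bigl (fun i => (i \in A) && (i != u))).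
    exact: leq_sum.
  by move=> x; rewrite !inE andbC.
have := cardsD1 u A; rewrite uA; lia.
Qed.

Lemma path_leaves A u v p : path (@adj G) u p -> last u p = v ->
  u \in A -> v \notin A ->
  exists z, [&& z \in zip (u :: p) p, z.1 \in A, z.2 \notin A & adj z.1 z.2].
Proof.
move=> + <-; elim: p u => [|b p IHp] u /=; first by move=> _ ->.
case/andP=> ub pb uA; case: (boolP (b \in A)) => bA lA; last first.
  by exists (u, b); rewrite /= mem_head uA bA.
have [z /andP[zp zA]] := IHp b pb bA lA.
by exists z; rewrite inE zp orbT.
Qed.

(** The easy half of Menger's theorem: choosing for each path a pair along which it leaves [A] is
    injective, since the paths share no edge. *)
Lemma disjoint_paths_cut k (ps : 'I_k -> seq G) A u v :
  (forall i, is_path u v (ps i)) ->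
  (forall i j, i != j -> [disjoint path_edges u (ps i) & path_edges u (ps j)]) ->
  u \in A -> v \notin A -> k <= arcs A (~: A).
Proof.
move=> ps_path ps_disj uA vA.
have leave i : exists z, [&& z \in zip (u :: ps i) (ps i), z.1 \in A,
    z.2 \notin A & adj z.1 z.2].
  by case/and3P: (ps_path i) => pi /eqP li _; apply: path_leaves li uA vA.
pose e i := xchoose (leave i).
have e_inj : injective e.
  move=> i j eq_e; apply/eqP; apply: contraT => /ps_disj/pred0P.
  have /andP[ei _] := xchooseP (leave i); have /andP[ej _] := xchooseP (leave j).
  move/(_ [set (e i).1; (e i).2])/negP; case; apply/andP; split.
    by apply/imsetP; exists (e i).
  by apply/imsetP; exists (e j) => //; rewrite eq_e.
rewrite arcs_card -[X in X <= _]card_ord -(card_codom e_inj).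
apply/subset_leq_card/subsetP => _ /codomP[i ->].
have /and4P[_ iA iB i_adj] := xchooseP (leave i).
by rewrite !inE iA iB.
Qed.

End Arcs.

(** * Cuts and degrees after deleting edges *)

Section Deletion.
Variables (G : sgraph) (F : {set {set G}}).
Implicit Types (A : {set G}).

(** Pairs are oriented out of [A], so an edge of [F] is counted at most once. *)
Definition cut_in A : {set G * G} :=
  [set z in setX A (~: A) | adj z.1 z.2 && ([set z.1; z.2] \in F)].

Lemma arcs_del A :
  @arcs G A (~: A) = @arcs (del_edges F) A (~: A) + #|cut_in A|.
Proof.
rewrite !arcs_card -(cardsID [set z | [set z.1; z.2] \in F]) addnC.
congr addn; apply: eq_card => z; rewrite !inE /=.
  by rewrite /del_adj; case: (_ \in F); rewrite /= ?andbF ?andbT.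
by rewrite -!andbA.
Qed.

Lemma pair_set_inj A : {in setX A (~: A) &, injective (fun z : G * G => [set z.1; z.2])}.
Proof.
move=> [x y] [a b] /=; rewrite !inE /= => /andP[xA yA] /andP[aA bA].
by case/set2_inj => [//|[_ ey]]; rewrite ey aA in yA.
Qed.

Lemma card_cut_in A : #|cut_in A| <= #|F|.
Proof.
rewrite -(card_in_imset (f := fun z : G * G => [set z.1; z.2])); last first.
  by move=> z t /setIdP[zA _] /setIdP[tA _]; apply: pair_set_inj zA tA.
by apply/subset_leq_card/subsetP => _ /imsetP[z /setIdP[_ /andP[_ zF]] ->].
Qed.

Lemma deg_del_le x : @deg (del_edges F) x <= @deg G x.
Proof.
apply/subset_leq_card/subsetP => y; rewrite !inE => /andP[//].
Qed.

Lemma del_2coloring c : @proper_2coloring G c -> @proper_2coloring (del_edges F) c.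
Proof. by move=> col x y /andP[/col]. Qed.

End Deletion.

(** The bound on [k] accounts for the default value [#|G|] of the minimum. *)
Lemma leq_min_deg (G : sgraph) k :
  k <= #|G| -> k <= min_deg G <-> forall x : G, k <= deg x.
Proof.
rewrite /min_deg => kG; split=> [le x|le]; last first.
  by elim/big_ind: _ => // a b; rewrite leq_min => -> ->.
apply: leq_trans le _; have := mem_index_enum x.
elim: (index_enum G) => //= y r IHr; rewrite inE big_cons geq_min.
by case/predU1P=> [->|/IHr->]; rewrite ?leqnn ?orbT.
Qed.

(** * Bubble-sort star graphs *)

Lemma lift_perm_inj n (i j : 'I_n.+1) : injective (lift_perm i j).
Proof.
move=> s t eq_st; apply/permP => k; apply: (@lift_inj _ j).
by rewrite -!(lift_perm_lift i) eq_st.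
Qed.

Lemma lift_perm_imset n (i j : 'I_n.+1) :
  [set lift_perm i j s | s in [set: 'S_n]] = [set x : 'S_n.+1 | x i == j].
Proof.
apply/setP => x; rewrite inE; apply/imsetP/eqP => [[s _ ->]|xi].
  exact: lift_perm_id.
(* The preimage deletes the entry [j] at position [i] and renumbers; the default of [odflt] is never
   reached, since [j] occurs only at [i]. *)
have inj_u : injective (fun k => odflt k (unlift j (x (lift i k)))).
  move=> k l; case: (unliftP j (x (lift i k))) => [a xk|]; last first.
    by rewrite -xi => /perm_inj/eqP; rewrite eq_sym (negPf (neq_lift _ _)).
  case: (unliftP j (x (lift i l))) => [b xl|]; last first.
    by rewrite -xi => /perm_inj/eqP; rewrite eq_sym (negPf (neq_lift _ _)).
  by move=> /= ab; apply/(@lift_inj _ i)/(@perm_inj _ x); rewrite xk xl ab.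
exists (perm inj_u) => //; apply/permP => k.
case: (unliftP i k) => [a ->|->]; last by rewrite lift_perm_id.
rewrite lift_perm_lift permE; case: unliftP => [b ->//|].
by rewrite -xi => /perm_inj/eqP; rewrite eq_sym (negPf (neq_lift _ _)).
Qed.

Lemma card_perm_at n (i j : 'I_n.+1) : #|[set x : 'S_n.+1 | x i == j]| = n`!.
Proof.
rewrite -lift_perm_imset card_imset ?cardsT ?card_Sn //; exact: lift_perm_inj.
Qed.

Lemma card_perm_at2 n (i a j b : 'I_n) : i != a -> j != b ->
  #|[set x : 'S_n | (x i == j) && (x a == b)]| = n.-2`!.
Proof.
case: n i a j b => [[]//|[i a|n i a j b]]; first by rewrite !ord1.
case: (unliftP i a) => [a' -> _|->]; last by rewrite eqxx.
case: (unliftP j b) => [b' -> _|->]; last by rewrite eqxx.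
rewrite -(card_perm_at a' b') -[RHS](card_imset _ (@lift_perm_inj _ i j)).
apply: eq_card => x; rewrite inE; apply/andP/imsetP => [[xi xa]|[s]].
  have: x \in [set x : 'S_n.+2 | x i == j] by rewrite inE.
  rewrite -lift_perm_imset => /imsetP[s _ ex]; exists s => //.
  by move: xa; rewrite inE ex lift_perm_lift (inj_eq lift_inj).
by rewrite inE => /eqP sa ->; rewrite lift_perm_id lift_perm_lift sa !eqxx.
Qed.

Section Swaps.
Variable n : nat.
Implicit Types (x y : BS n) (i k : 'I_n).

Definition bs_swap (z : 'I_n * 'I_n) : bool :=
  (0 < z.2) && ((z.1 == z.2.-1 :> nat) || (z.1 == 0 :> nat)).

Lemma bs_swap_lt z : bs_swap z -> z.1 < z.2.
Proof. by case/andP=> z2 /orP[]/eqP->; rewrite ?ltn_predL. Qed.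

Lemma bs_adjP x y :
  reflect (exists2 z, bs_swap z & y = (tperm z.1 z.2 * x)%g) (adj x y).
Proof.
apply: (iffP existsP) => [[i /existsP[k /and3P[k0 ik /eqP->]]]|[[i k]]].
  by exists (i, k); rewrite // /bs_swap k0.
by case/andP=> k0 ik ->; exists i; apply/existsP; exists k; rewrite k0 ik eqxx.
Qed.

Lemma BS_2coloring : proper_2coloring (fun x : BS n => odd_perm x).
Proof.
move=> x y /bs_adjP[z /bs_swap_lt lt ->]; rewrite odd_permM odd_tperm.
by rewrite neq_ltn lt; case: odd_perm.
Qed.

Lemma tperm_lt_inj (z t : 'I_n * 'I_n) : z.1 < z.2 -> t.1 < t.2 ->
  tperm z.1 z.2 = tperm t.1 t.2 -> z = t.
Proof.
case: z t => [i k] [a b] /= ik ab eq_t.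
have := tpermL i k; have := tpermR i k; rewrite eq_t.
case: tpermP => [||_ _ ki]; last by rewrite ki ltnn in ik.
  move=> ka bi; move: ik ab; rewrite ka -bi => ik ab.
  by have := ltn_trans ik ab; rewrite ltnn.
move=> -> ->; by case: tpermP => // _ _ ib; rewrite ib ltnn in ab.
Qed.

End Swaps.

(** By second position: none for 0, one for 1, where both rules give the pair (0, 1), and two for
    each of the other n - 2 positions. *)
Lemma card_bs_swap n : 1 < n -> #|[set z : 'I_n * 'I_n | bs_swap z]| = 2 * n - 3.
Proof.
case: n => [//|[//|m]] _; rewrite -sum1_card (partition_big snd xpredT) //=.
have fiber (k : 'I_m.+2) (B : {set 'I_m.+2}) :
    (forall i, bs_swap (i, k) = (i \in B)) ->
    \sum_(z | (z \in [set z | bs_swap z]) && (z.2 == k)) 1 = #|B|.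
  move=> swapB; rewrite sum1dep_card -[RHS](card_imset _ (f := pair^~ k)).
    apply: eq_card => -[i j]; rewrite !inE /=; apply/andP/imsetP => [[ij /eqP jk]|].
      by exists i; rewrite -?swapB -?jk.
    by case=> a aB [-> ->]; rewrite swapB.
  by move=> i j [].
rewrite !big_ord_recl (fiber _ set0) => [|i]; last by rewrite inE.
rewrite (fiber _ [set ord0]) => [|i]; last by rewrite inE /bs_swap /= orbb.
rewrite cards0 cards1 (eq_bigr (fun=> 2)) => [|k _].
  by rewrite sum_nat_const card_ord; lia.
rewrite (fiber _ [set ord0; widen_ord (leqnSn _) (lift ord0 k)]) ?cards2 // => i.
by rewrite !inE /bs_swap /= orbC.
Qed.


Lemma deg_BS n (x : BS n) : 1 < n -> deg x = 2 * n - 3.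
Proof.
move=> n1; rewrite -card_bs_swap //.
rewrite -(card_in_imset (f := fun z : 'I_n * 'I_n => (tperm z.1 z.2 * x)%g)).
  apply: eq_card => y; rewrite inE; apply/bs_adjP/imsetP => -[z].
    by move=> zs ->; exists z; rewrite ?inE.
  by rewrite inE => zs ->; exists z.
move=> z t; rewrite !inE => /bs_swap_lt zs /bs_swap_lt ts /mulIg.
exact: tperm_lt_inj.
Qed.

(** * Layers *)

Section Layers.
Variable m : nat.
Implicit Types (x y : BS m.+1) (i j : 'I_m.+1) (A B : {set BS m.+1}).

Definition layer j : {set BS m.+1} := [set x : {perm 'I_m.+1} | x ord_max == j].

(** Appends the last entry [i] and renumbers the other entries around it, which embeds [BS m] onto
    [layer i]. *)
Definition layer_lift i : BS m -> BS m.+1 := @lift_perm m ord_max i.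

Lemma layer_lift_inj i : injective (layer_lift i).
Proof. exact: lift_perm_inj. Qed.

Definition layer_trace i A : {set BS m} := layer_lift i @^-1: A.

Lemma card_layer j : #|layer j| = m`!.
Proof. exact: card_perm_at. Qed.

Lemma layer_trace_imset i A :
  layer_lift i @: layer_trace i A = A :&: layer i.
Proof.
rewrite /layer -lift_perm_imset; apply/setP => x; rewrite inE.
apply/imsetP/andP => [[s + ->]|[xA /imsetP[s _ ex]]].
  by rewrite inE => sA; rewrite imset_f ?inE.
by exists s; rewrite ?inE /layer_lift -?ex.
Qed.

Lemma card_layer_trace i A : #|layer_trace i A| = #|A :&: layer i|.
Proof. by rewrite -layer_trace_imset card_imset //; apply: layer_lift_inj. Qed.

Lemma lift_adj i (s t : BS m) : adj s t ->
  adj (layer_lift i s) (layer_lift i t).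
Proof.
case/bs_adjP=> -[a b] /andP[/= b0 ab] ->; apply/bs_adjP.
exists (lift ord_max a, lift ord_max b).
  by rewrite /bs_swap /= /bump !(leqNgt m) !ltn_ord b0.
rewrite /layer_lift -(lift_permM _ ord_max) /=; congr (_ * _)%g; apply/permP => k /=.
case: (unliftP ord_max k) => [k' ->|->]; last first.
  by rewrite lift_perm_id tpermD ?neq_lift // eq_sym neq_lift.
rewrite lift_perm_lift; case: tpermP => [->|->|/eqP ka /eqP kb].
- by rewrite tpermL.
- by rewrite tpermR.
- by rewrite tpermD // (inj_eq lift_inj) eq_sym.
Qed.

Lemma arcs_layer i A :
  arcs (layer_trace i A) (~: layer_trace i A) <=
  arcs (A :&: layer i) (layer i :\: A).
Proof.
have eqC : layer_lift i @: (~: layer_trace i A) =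
    layer i :\: A.
  have -> : ~: layer_trace i A = layer_trace i (~: A) by apply/setP => s; rewrite !inE.
  by rewrite layer_trace_imset setDE setIC.
rewrite -eqC -layer_trace_imset /arcs.
have inj (B : {set BS m}) : {in B &, injective (layer_lift i)}.
  by move=> s t _ _; apply: layer_lift_inj.
rewrite big_imset ?(inj _) //; apply: leq_sum => s _.
rewrite big_imset ?(inj _) //; apply: leq_sum => t _.
by case: (boolP (adj s t)) => // /(lift_adj i) ->.
Qed.

Lemma sum_layers A (F : BS m.+1 -> nat) :
  \sum_(x in A) F x = \sum_j \sum_(x in A :&: layer j) F x.
Proof.
rewrite (partition_big (fun x : {perm 'I_m.+1} => x ord_max) xpredT) //=.
by apply: eq_bigr => j _; apply: eq_bigl => x; rewrite !inE.
Qed.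

Lemma cut_layers A :
  arcs A (~: A) = \sum_i \sum_j arcs (A :&: layer i) (layer j :\: A).
Proof.
rewrite /arcs sum_layers; apply: eq_bigr => i _.
rewrite [RHS]exchange_big; apply: eq_bigr => x _; rewrite sum_layers.
by apply: eq_bigr => j _; apply: eq_bigl => y; rewrite !inE andbC.
Qed.

Hypothesis m_ge2 : 2 <= m.

(** The swaps that change the last entry are those with position 0 and with this one; they are
    distinct because [m] is at least 2. *)
Let pre_last : 'I_m.+1 := inord m.-1.

Lemma pre_lastE : pre_last = m.-1 :> nat.
Proof. by rewrite inordK // ltnS leq_pred. Qed.

(** A neighbour in another layer comes from one of the two swaps with the last position, and its
    layer is the entry of [x] at the other position swapped. *)
Lemma cross_nbrs x j : x \notin layer j ->
  \sum_(y in layer j) adj x y =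
    ((x : {perm _}) ord0 == j) + ((x : {perm _}) pre_last == j).
Proof.
rewrite inE => xj.
(* Each indicator is spread into a sum over [y] supported at one neighbour, so that both sides can
   be compared term by term. *)
have nbr (a : 'I_m.+1) : a != ord_max ->
    \sum_(y : BS m.+1) ((y == (tperm a ord_max * x)%g) : nat) * ((x : {perm _}) a == j)
     = ((x : {perm _}) a == j).
  move=> a_max; rewrite (bigD1 (tperm a ord_max * x)%g) //= eqxx mul1n.
  by rewrite big1 ?addn0 // => y /negPf->.
have neq0 : ord0 != ord_max :> 'I_m.+1 by rewrite -val_eqE /=; lia.
have neq1 : pre_last != ord_max by rewrite -val_eqE /= pre_lastE; lia.
have neq01 : pre_last != ord0 by rewrite -val_eqE /= pre_lastE; lia.
rewrite -[in RHS](nbr ord0) // -[in RHS](nbr pre_last) // -big_split /=.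
rewrite big_mkcond; apply: eq_bigr => y _.
rewrite [y \in _]inE -[bs_adj x y]/(@adj (BS m.+1) x y).
case: (boolP (adj x y)) => [/bs_adjP[[a b] ab ->]|nadj].
  have lt_ab := bs_swap_lt ab; rewrite /= in lt_ab.
  have swap_eq (c : 'I_m.+1) : c != ord_max ->
      ((tperm a b * x)%g == (tperm c ord_max * x)%g) = ((a, b) == (c, ord_max)).
    move=> cmax; apply/eqP/eqP => [/mulIg eq_t|[-> ->]//].
    apply: (@tperm_lt_inj _ (a, b) (c, ord_max)) => //=.
    by rewrite ltn_neqAle leq_ord andbT.
  rewrite !swap_eq // !xpair_eqE permM /=.
  have [eb|b_max] := eqVneq b ord_max; last first.
    rewrite !andbF tpermD ?(negPf xj) // -val_eqE /=.
  by have := ltn_ord b; lia.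
  rewrite eb tpermR !andbT; move: ab; rewrite eb /bs_swap /= => /andP[_].
  have -> : (a == m.-1 :> nat) = (a == pre_last) by rewrite -val_eqE /= pre_lastE.
  have -> : (a == 0 :> nat) = (a == ord0) by [].
  case/orP => /eqP->; rewrite eqxx mul1n.
    by rewrite (negPf neq01); case: eqP.
  by rewrite [ord0 == _]eq_sym (negPf neq01); case: eqP.
have nswap (a : 'I_m.+1) : bs_swap (a, ord_max) -> (y == (tperm a ord_max * x)%g) = false.
  by move=> sw; apply: contraNF nadj => /eqP ->; apply/bs_adjP; exists (a, ord_max).
rewrite if_same !nswap // /bs_swap /= ?pre_lastE ?eqxx ?orbT ?andbT; lia.
Qed.

Lemma sum_cross_nbrs i A : A \subset layer i ->
  \sum_(j | j != i) arcs A (layer j) = 2 * #|A|.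
Proof.
move=> /subsetP Ai; rewrite /arcs exchange_big /= mulnC -sum_nat_const.
apply: eq_bigr => x /Ai; rewrite inE => /eqP xi.
rewrite (eq_bigr (fun j => ((x : {perm _}) ord0 == j) + ((x : {perm _}) pre_last == j))).
  have one (a : 'I_m.+1) : a != ord_max -> \sum_(j | j != i) ((x : {perm _}) a == j) = 1.
    move=> a_max; rewrite (bigD1 ((x : {perm _}) a)) /=.
      by rewrite eqxx big1 // => j /andP[_ /negPf]; rewrite eq_sym => ->.
    by rewrite -xi (inj_eq perm_inj).
  by rewrite big_split /= !one // -val_eqE /= ?pre_lastE; lia.
by move=> j ji; apply: cross_nbrs; rewrite inE xi eq_sym.
Qed.

(** The entries at positions 0 and [pre_last] differ, so a vertex has at most one neighbour in any
    given other layer. *)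
Lemma arcs_cross_le i j A : i != j -> A \subset layer i -> arcs A (layer j) <= #|A|.
Proof.
move=> ij /subsetP Ai; rewrite -sum1_card; apply: leq_sum => x /Ai.
rewrite inE => /eqP xi; rewrite cross_nbrs ?inE ?xi //.
case: eqP => [<-|_]; last by case: (_ == _).
rewrite (inj_eq perm_inj) -val_eqE /= pre_lastE.
by case: eqP => //; lia.
Qed.

Lemma arcs_layers i j : i != j -> arcs (layer i) (layer j) = 2 * m.-1`!.
Proof.
move=> ij; rewrite /arcs.
rewrite (eq_bigr (fun x : BS m.+1 =>
    ((x : {perm _}) ord0 == j) + ((x : {perm _}) pre_last == j))).
  have count (a : 'I_m.+1) : a != ord_max ->
      \sum_(x in layer i) ((x : {perm _}) a == j) = m.-1`!.
    move=> a_max; rewrite sum_card_pred.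
    rewrite -(@card_perm_at2 m.+1 ord_max a i j) 1?[ord_max == _]eq_sym //.
    by apply: eq_card => x; rewrite !inE.
  by rewrite big_split /= !count ?mul2n ?addnn // -val_eqE /= ?pre_lastE; lia.
by move=> x; rewrite inE => /eqP xi; apply: cross_nbrs; rewrite inE xi.
Qed.

End Layers.

(** * Counting edges across a layered cut *)

(* Lower bounds for the cut (size b) of a set of s vertices in a copy of BS_m,
   which has M = m! vertices. *)
Definition layer_bound (m M s b : nat) : Prop :=
  [/\ 0 < s < M -> 2 * m - 3 <= b,
      1 < s < M - 1 -> 4 * m - 8 <= b,
      (s == 3) || (s == M - 3) -> 6 * m - 13 <= b
    & 3 < s < M - 3 -> 8 * m - 20 <= b].

Lemma layer_bound1 m M s b : layer_bound m M s b -> 0 < s < M -> 2 * m - 3 <= b.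
Proof. by case. Qed.

(** [C] stands for the cut edges to other layers. For m >= 4, either [s < M - 3] and [8 * m - 20]
    plus [2 * s >= 8] suffice, or [2 * s] alone does; for m = 3 only [s] = 4 and [s] = 5 occur. *)
Lemma one_mixed_layer m M s b C : 3 <= m -> (m = 3 -> M = 6) ->
  (4 <= m -> 6 * m <= M) -> layer_bound m M s b -> 0 < s < M ->
  2 * s <= C -> 4 <= s -> 8 * m - 12 <= b + C.
Proof.
move=> m_ge3 M3 M4 [b1 b2 b3 b4] sM sC s4; have [m3|/M4 mM] : m = 3 \/ 4 <= m by lia.
  have M6 := M3 m3; have {}b1 := b1 sM; have [s5|s5] : s = 5 \/ s = 4 by lia.
    by lia.
  by have {}b2 : 4 * m - 8 <= b; [apply: b2 | ]; lia.
have {}b1 := b1 sM; have [sl|sl] := ltnP s (M - 3); last by lia.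
by have {}b4 : 8 * m - 20 <= b; [apply: b4; rewrite s4 sl | lia].
Qed.

(** Cases on the larger size. Sizes 2 and 2 are tight: [4 * m - 8] twice, plus [C >= 4]. *)
Lemma two_mixed_layers m M s t b b' C : 3 <= m -> 2 * m <= M ->
  layer_bound m M s b -> layer_bound m M t b' -> 0 < s < M -> 0 < t < M ->
  2 * s <= C -> 2 * t <= C -> 4 <= s + t -> 8 * m - 12 <= b + b' + C.
Proof.
move=> m_ge3 mM bs bt sM tM sC tC st4.
wlog le_st : s t b b' bs bt sM tM sC tC st4 / s <= t.
  move=> W; case: (leqP s t) => [|/ltnW] le; first exact: (W s t).
  by rewrite [b + b']addnC; apply: (W t s) => //; rewrite addnC.
have b1 := layer_bound1 bs sM; have b'1 := layer_bound1 bt tM.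
case: bs bt => [_ b2 b3 _] [_ b'2 b'3 b'4].
have [t4|t3] := ltnP 3 t.
  have [tl|tl] := ltnP t (M - 3); last by lia.
  by have {}b'4 : 8 * m - 20 <= b'; [apply: b'4; rewrite t4 tl | lia].
have [t_eq3|t_eq2] : t = 3 \/ t = 2 by lia.
  have {}b'3 : 6 * m - 13 <= b' by apply: b'3; rewrite t_eq3.
  lia.
have {}b'2 : 4 * m - 8 <= b' by apply: b'2; lia.
have {}b2 : 4 * m - 8 <= b by apply: b2; lia.
lia.
Qed.

(** [K + s <= C + M] reflects an empty layer: at most [M - s] of the [K] edges towards it start
    outside the set. If [M - 1 <= s], this gives [C >= 2 * m - 3], enough together with the three
    inner cuts. *)
Lemma three_mixed_layers m M K s t r b b' b'' C C' C'' :
  3 <= m -> 2 * m <= M -> 2 * m - 2 <= K ->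
  layer_bound m M s b -> layer_bound m M t b' -> layer_bound m M r b'' ->
  0 < s < M -> 0 < t < M -> 0 < r < M ->
  K + s <= C + M -> K + t <= C' + M -> K + r <= C'' + M ->
  2 * (s + t + r) <=
    C + C' + C'' + 2 * (minn s t + minn s r + minn t r) ->
  4 <= s + t + r -> 8 * m - 12 <= b + b' + b'' + (C + C' + C'').
Proof.
move=> m_ge3 mM mK bs bt br sM tM rM sC tC rC cross str.
have b1 := layer_bound1 bs sM; have b'1 := layer_bound1 bt tM.
have b''1 := layer_bound1 br rM.
have [s_top|s_low] := leqP (M - 1) s.
  by clear - m_ge3 mK b1 b'1 b''1 sM sC s_top; lia.
have [t_top|t_low] := leqP (M - 1) t.
  by clear - m_ge3 mK b1 b'1 b''1 tM tC t_top; lia.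
have [r_top|r_low] := leqP (M - 1) r.
  by clear - m_ge3 mK b1 b'1 b''1 rM rC r_top; lia.
have {}bs : 1 < s -> 4 * m - 8 <= b by case: bs => _ + _ _ s1; apply; rewrite s1.
have {}bt : 1 < t -> 4 * m - 8 <= b' by case: bt => _ + _ _ t1; apply; rewrite t1.
have {}br : 1 < r -> 4 * m - 8 <= b'' by case: br => _ + _ _ r1; apply; rewrite r1.
(* Equal sizes are at least 2, and 3(4m - 8) >= 8m - 12. Unequal sizes force two cut edges between
   layers, and some size is still at least 2. *)
have [/andP[/eqP st /eqP tr]|neq] := boolP ((s == t) && (t == r)).
  have r1 : 1 < r by clear - st tr str; lia.
  have := bs; have := bt; have := br; rewrite st tr.
  move=> /(_ r1) b2 /(_ r1) b'2 /(_ r1) b''2.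
  by clear - m_ge3 b2 b'2 b''2; lia.
have cross2 : 2 <= C + C' + C'' by clear - cross neq; lia.
have [s1|/bs b2] := leqP s 1; last by clear - m_ge3 b2 b'1 b''1 cross2; lia.
have [t1|/bt b'2] := leqP t 1; last by clear - m_ge3 b1 b'2 b''1 cross2; lia.
have r1 : 1 < r by clear - s1 t1 str; lia.
by have b''2 := br r1; clear - m_ge3 b1 b'1 b''2 cross2; lia.
Qed.

(* s i is the number of vertices of the set in layer i; for i != j, c i j and e i j
   count the pairs of adjacent vertices, the first in the set and in layer i, the
   second in layer j and outside, resp. inside, the set; c i i is the cut inside
   layer i.  Here m! = m * f, and 2 * f edges join any two layers. *)
Section LayeredCut.
Variables (I : finType) (m f : nat) (s : I -> nat) (c e : I -> I -> nat).
Let M := m * f.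
Let K := 2 * f.
Hypotheses (m_ge3 : 3 <= m) (cardI : #|I| = m.+1).
Hypotheses (f_ge : 2 * m - 4 <= f) (f3 : m = 3 -> f = 2) (f4 : 4 <= m -> 6 <= f).
Hypothesis s_le : forall i, s i <= M.
Hypothesis c_layer : forall i, layer_bound m M (s i) (c i i).
Hypothesis c_row : forall i, \sum_(j | j != i) (c i j + e i j) = 2 * s i.
Hypothesis e_le : forall i j, i != j -> e i j <= s i /\ e i j <= s j.
Hypothesis c_cross : forall i j, i != j -> K + s i <= c i j + e i j + M.

Let cut := \sum_i \sum_j c i j.

Let f_ge2 : 2 <= f. Proof. lia. Qed.
Let M_ge : 2 * m <= M. Proof. by rewrite mulnC leq_mul2l f_ge2 orbT. Qed.
Let M_ge4 : 4 <= m -> 6 * m <= M.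
Proof. by move=> m4; rewrite mulnC leq_mul2l f4 // orbT. Qed.
Let M_eq3 : m = 3 -> M = 6.
Proof. by move=> m3; rewrite /M f3 // m3. Qed.

(** All [K >= 4 * m - 8] edges between layers [i] and [k] are cut, and each of the m - 1 other
    layers adds at least 4. *)
Lemma cut_full_empty i k : s i = M -> s k = 0 -> 8 * m - 12 <= cut.
Proof.
move=> si sk; have ik : i != k by apply/eqP => eik; move: si; rewrite eik sk; lia.
(* The three terms are at least [K - s j], [2 * m - 3] if layer [j] is mixed, and
   [K - (M - s j)]. *)
have third j : (j != i) && (j != k) -> 4 <= c i j + (c j j + c j k).
  case/andP=> ji jk; have [lo _ _ _] := c_layer j.
  have := c_cross jk; have [_] := e_le jk; rewrite sk.
  have := @c_cross i j; have := @e_le i j; rewrite eq_sym ji si.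
  move=> /(_ isT)[_ eij] /(_ isT).
  have := s_le j; have [m3|m4] : m = 3 \/ 4 <= m by lia.
    by have := M_eq3 m3; have := f3 m3; rewrite /K; lia.
  by rewrite /K; have := f4 m4; have := M_ge4 m4; lia.
have cik : K <= c i k by have := c_cross ik; have [_] := e_le ik; rewrite si sk; lia.
have : 4 * (m - 1) <= \sum_(j | (j != i) && (j != k)) (c i j + (c j j + c j k)).
  have -> : m - 1 = #|[pred j | (j != i) && (j != k)]|.
    have := cardC (pred2 i k); rewrite cardI card2 ik => card3.
    have -> : #|[pred j | (j != i) && (j != k)]| = #|[predC pred2 i k]|.
      by apply: eq_card => j; rewrite !inE negb_or.
    by move/eqP: card3; rewrite add2n eqSS => /eqP <-; rewrite subn1.
  rewrite mulnC -sum_nat_const; exact: leq_sum.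
rewrite !big_split /= => tot.
have rowi : c i k + \sum_(j | (j != i) && (j != k)) c i j <= \sum_j c i j.
  rewrite [X in _ <= X](bigD1 i) //= [X in _ <= _ + X](bigD1 k) 1?eq_sym //=.
  exact: leq_addl.
have rows : \sum_(j | (j != i) && (j != k)) c j j + \sum_(j | (j != i) && (j != k)) c j k
    <= \sum_(j | j != i) \sum_l c j l.
  rewrite -big_split [X in _ <= X](bigD1 k) 1?eq_sym //=; apply: leq_trans (leq_addl _ _).
  apply: leq_sum => j /andP[_ jk].
  by rewrite [X in _ <= X](bigD1 j) //= leq_add2l (bigD1 k) 1?eq_sym //= leq_addr.
rewrite /cut (bigD1 i) //=; move: f_ge; rewrite /K in cik; lia.
Qed.

Definition mixed := [set i | 0 < s i < M].

Lemma cut_ge_mixed : \sum_(i in mixed) c i i <= cut.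
Proof.
rewrite /cut [X in _ <= X](bigID (mem mixed)) /=; apply: leq_trans (leq_addr _ _).
by apply: leq_sum => i _; rewrite (bigD1 i) //= leq_addr.
Qed.

Lemma cut_many_mixed : 4 <= #|mixed| -> 8 * m - 12 <= cut.
Proof.
move=> mx; apply: leq_trans cut_ge_mixed.
apply: (@leq_trans (#|mixed| * (2 * m - 3))).
  by rewrite (_ : 8 * m - 12 = 4 * (2 * m - 3)) ?leq_mul2r ?mx ?orbT // mulnBr mulnA.
rewrite -sum_nat_const; apply: leq_sum => i; rewrite inE => si.
by have [/(_ si)] := c_layer i.
Qed.

(** Without full layers the whole set lies in the mixed layers, of which there are one, two or
    three; each number has its own estimate above. *)
Lemma cut_no_full l : (forall i, s i < M) -> s l = 0 -> 4 <= \sum_i s i ->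
  #|mixed| <= 3 -> 8 * m - 12 <= cut.
Proof.
move=> not_full sl sum_s mx3.
have mixedE i : (i \in mixed) = (0 < s i) by rewrite inE not_full andbT.
have sum_mixed : \sum_i s i = \sum_(i in mixed) s i.
  rewrite [RHS]big_mkcond; apply: eq_bigr => i _; rewrite mixedE; by case: (s i).
have row i : 2 * s i <= \sum_(j | j != i) c i j + \sum_(j in mixed | j != i) e i j.
  rewrite -c_row big_split leq_add2l /= [X in X <= _](bigID (mem mixed)) /=.
  rewrite (eq_bigl (fun j => (j \in mixed) && (j != i))) => [|j]; last by rewrite andbC.
  rewrite [X in _ + X]big1 ?addn0 // => j /andP[ji].
  rewrite mixedE -leqNgt leqn0 => /eqP sj.
  by have [] := @e_le i j; rewrite 1?eq_sym // sj; lia.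
have cutE : \sum_(i in mixed) (c i i + \sum_(j | j != i) c i j) <= cut.
  rewrite /cut [X in _ <= X](bigID (mem mixed)) /=; apply: leq_trans (leq_addr _ _).
  by apply: leq_sum => i _; rewrite [X in _ <= X](bigD1 i).
(* Edges from the set to the empty layer [l] are all cut, and at most [M - s i] of the [K] edges to
   it start elsewhere in layer [i]. *)
have row_l i : i \in mixed -> K + s i <= \sum_(j | j != i) c i j + M.
  rewrite mixedE => si; have il : i != l by apply/eqP => eil; move: si; rewrite eil sl.
  have := c_cross il; have [_] := e_le il; rewrite (bigD1 l) 1?eq_sym //= sl; lia.
have en := enum_uniq mixed; have sz : size (enum mixed) <= 3 by rewrite -cardE.
move: sum_s; rewrite sum_mixed -big_enum; move: cutE; rewrite -big_enum /=.
have rowE i : 2 * s i <= \sum_(j | j != i) c i j + \sum_(j <- enum mixed | j != i) e i j.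
  by apply: leq_trans (row i) _; rewrite -big_enum_cond.
have in_mixed i : i \in enum mixed -> 0 < s i < M by rewrite mem_enum inE.
have row_l' i : i \in enum mixed -> K + s i <= \sum_(j | j != i) c i j + M.
  by rewrite mem_enum; apply: row_l.
(* Only these facts about the enumeration are kept, so that it can be split by length; length 0
   contradicts the size of the set. *)
move: (enum mixed) en sz rowE in_mixed row_l'.
move=> [|i [|j [|k [|]]]] //= un _ rowE inm rowl.
- by rewrite !big_nil; lia.
- rewrite !big_cons !big_nil; have := rowE i; rewrite big_cons eqxx big_nil /=.
  have := inm i; rewrite mem_head => /(_ isT) si rowi cuti sumi.
  rewrite !addn0 in rowi cuti sumi; apply: leq_trans cuti.
  exact: one_mixed_layer m_ge3 M_eq3 M_ge4 (c_layer i) si rowi sumi.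
- move: un; rewrite inE andbT => ij; have ji : j != i by rewrite eq_sym.
  have [eij1 eij2] := e_le ij; have [eji1 eji2] := e_le ji.
  rewrite !big_cons !big_nil; have := rowE i; have := rowE j.
  rewrite !big_cons !big_nil !eqxx ij ji /= !addn0.
  have := inm i; have := inm j; rewrite !inE !eqxx orbT => /(_ isT) sj /(_ isT) si.
  move=> rowj rowi cuti sumi; apply: leq_trans cuti; rewrite addnACA.
  (* The two rows are added, with [e i j] and [e j i] both bounded by [s j] for the first goal and
     by [s i] for the second. *)
  apply: (two_mixed_layers m_ge3 M_ge (c_layer i) (c_layer j) si sj) => //.
    by clear - rowi rowj eij2 eji1; lia.
  by clear - rowi rowj eij1 eji2; lia.
- move: un; rewrite !inE negb_or !andbT => /andP[/andP[ij ik] jk].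
  have ji : j != i by rewrite eq_sym.
  have ki : k != i by rewrite eq_sym.
  have kj : k != j by rewrite eq_sym.
  have [eij1 eij2] := e_le ij; have [eji1 eji2] := e_le ji.
  have [eik1 eik2] := e_le ik; have [eki1 eki2] := e_le ki.
  have [ejk1 ejk2] := e_le jk; have [ekj1 ekj2] := e_le kj.
  rewrite !big_cons !big_nil; have := rowE i; have := rowE j; have := rowE k.
  rewrite !big_cons !big_nil !eqxx ij ji ik ki jk kj /= !addn0.
  have := rowl i; have := rowl j; have := rowl k.
  have := inm i; have := inm j; have := inm k; rewrite !inE !eqxx !orbT.
  move=> /(_ isT) sk /(_ isT) sj /(_ isT) si /(_ isT) lk /(_ isT) lj /(_ isT) li.
  move=> rowk rowj rowi cuti sumi; apply: leq_trans cuti.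
  have K_ge : 2 * m - 2 <= K by rewrite /K; clear - m_ge3 f_ge; lia.
  rewrite addnA in sumi; move: li lj lk rowi rowj rowk.
  move: (\sum_(x | x != i) c i x) (\sum_(x | x != j) c j x) (\sum_(x | x != k) c k x).
  move=> X Y Z li lj lk rowi rowj rowk.
  have cross : 2 * (s i + s j + s k) <=
      X + Y + Z + 2 * (minn (s i) (s j) + minn (s i) (s k) + minn (s j) (s k)).
    clear - rowi rowj rowk eij1 eij2 eji1 eji2 eik1 eik2 eki1 eki2
      ejk1 ejk2 ekj1 ekj2.
    lia.
  have := three_mixed_layers m_ge3 M_ge K_ge (c_layer i) (c_layer j) (c_layer k)
    si sj sk li lj lk cross sumi.
  by clear; lia.
Qed.


End LayeredCut.

(** * Edge cuts of bubble-sort star graphs *)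

Lemma card_BS m : #|BS m| = m`!.
Proof. by rewrite -card_Sn; apply: eq_card. Qed.

(** At most three vertices, say k, span at most k - 1 edges, so at least k(2m - 3) - 2(k - 1) edges
    leave them. *)
Lemma BS_small_cut m (B : {set BS m}) : 2 < m -> 0 < #|B| <= 3 ->
  (2 * m - 5) * #|B| + 2 <= arcs B (~: B).
Proof.
move=> m2 B3; have := sum_deg_small_cut (@BS_2coloring m) B3.
rewrite (eq_bigr (fun=> 2 * m - 3)) => [|x _]; last exact/deg_BS/ltnW.
rewrite sum_nat_const mulnC (_ : 2 * m - 3 = 2 * m - 5 + 2) ?mulnDl; lia.
Qed.

Lemma arcs_setC (G : sgraph) (B : {set G}) : arcs (~: B) (~: ~: B) = arcs B (~: B).
Proof. by rewrite setCK arcsC. Qed.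

(** A side of at most three vertices is covered by the small-cut bound for [B] or its complement,
    two larger sides by the second hypothesis. *)
Lemma BS_layer_bound m (B : {set BS m}) : 3 <= m ->
  (4 <= #|B| -> 4 <= #|~: B| -> 8 * m - 20 <= arcs B (~: B)) ->
  layer_bound m m`! #|B| (arcs B (~: B)).
Proof.
move=> m3 large; have cardC : #|B| + #|~: B| = m`! by rewrite cardsC card_BS.
have small := BS_small_cut (B := B) m3; have smallC := BS_small_cut (B := ~: B) m3.
rewrite arcs_setC in smallC.
have M3 := leq_trans m3 (fact_geq m); rewrite -cardC in M3 *.
move: (arcs B _) #|B| #|~: B| M3 large small smallC => b a a' M3 large small smallC.
split.
- move=> H; have [a3|a3] := leqP a 3; first by have := small; nia.
  have [a'3|a'3] := leqP a' 3; first by have := smallC; nia.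
  by have := large a3 a'3; lia.
- move=> H; have [a3|a3] := leqP a 3; first by have := small; nia.
  have [a'3|a'3] := leqP a' 3; first by have := smallC; nia.
  by have := large a3 a'3; lia.
- case/orP => /eqP a_eq; first by have := small; rewrite a_eq; lia.
  have a'_eq : a' = 3 by lia.
  by have := smallC; rewrite a'_eq; lia.
- by move=> H; apply: large; lia.
Qed.

Section Step.
Variable m : nat.
Hypothesis m_ge3 : 3 <= m.
Hypothesis IHm : forall B : {set BS m}, 4 <= #|B| -> 4 <= #|~: B| ->
  8 * m - 20 <= arcs B (~: B).
Variable A : {set BS m.+1}.

Let f := m.-1`!.
Let s (i : 'I_m.+1) := #|A :&: layer i|.
Let c (i j : 'I_m.+1) := arcs (A :&: layer i) (layer j :\: A).
Let e (i j : 'I_m.+1) := arcs (A :&: layer i) (layer j :&: A).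

Lemma pred_factorial_bounds :
  [/\ 2 * m - 4 <= f, m = 3 -> f = 2 & 4 <= m -> 6 <= f].
Proof.
have fact_ge k : 2 <= k -> 2 * k - 2 <= k`!.
  by elim: k => // -[|[|k]] IHk // _; rewrite factS; have := IHk isT; nia.
split; first by have := fact_ge m.-1; rewrite /f; lia.
  by rewrite /f => ->.
by move=> m4; rewrite /f (@leq_fact 3) //; lia.
Qed.

Lemma fact_layer : m`! = m * f.
Proof. by rewrite /f -{1}(ltn_predK m_ge3) factS (ltn_predK m_ge3). Qed.

Lemma layer_cut_bound i : layer_bound m (m * f) (s i) (c i i).
Proof.
have [b1 b2 b3 b4] := BS_layer_bound m_ge3 (IHm (B := layer_trace i A)).
rewrite -fact_layer /s -card_layer_trace; have le := arcs_layer i A.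
by split=> H; apply: leq_trans le; auto.
Qed.

(** Three cases: at least four mixed layers, a full layer beside the empty one, or neither. *)
Lemma BS_cut_empty_layer l : A :&: layer l = set0 -> 4 <= #|A| ->
  8 * m - 12 <= arcs A (~: A).
Proof.
move=> Al A4; rewrite cut_layers.
have [f1 f2 f3] := pred_factorial_bounds.
have Mf := fact_layer; have c_layer := layer_cut_bound.
have s_le i : s i <= m * f.
  by rewrite -Mf -(card_layer i) subset_leq_card // subsetIr.
have c_row i : \sum_(j | j != i) (c i j + e i j) = 2 * s i.
  rewrite -(sum_cross_nbrs (ltnW m_ge3) (subsetIr A (layer i))).
  by apply: eq_bigr => j _; rewrite (arcs_splitr _ _ A) addnC.
have e_le i j : i != j -> e i j <= s i /\ e i j <= s j.
  move=> ij; split.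
    apply: leq_trans (arcs_cross_le (ltnW m_ge3) ij (subsetIr A (layer i))).
    by rewrite [X in _ <= X](arcs_splitr _ _ A) leq_addr.
  rewrite /e [layer j :&: A]setIC arcsC; rewrite eq_sym in ij.
  apply: leq_trans (arcs_cross_le (ltnW m_ge3) ij (subsetIr A (layer j))).
  by rewrite [X in _ <= X](arcs_splitr _ _ A) [layer i :&: A]setIC leq_addr.
(* Of the [2 * f] edges between the two layers, each vertex of [layer i :\: A] meets at most one. *)
have c_cross i j : i != j -> 2 * f + s i <= c i j + e i j + m * f.
  move=> ij; rewrite -(arcs_layers (ltnW m_ge3) ij) -Mf -(card_layer i).
  rewrite (arcs_splitl _ _ A) [X in X + _ + _](arcs_splitr _ _ A).
  rewrite -(cardsID A (layer i)).
  have := arcs_cross_le (ltnW m_ge3) ij (subsetDl (layer i) A).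
  by rewrite /c /e /s [layer i :&: A]setIC; lia.
have cardI : #|'I_m.+1| = m.+1 by rewrite card_ord.
have sl : s l = 0 by rewrite /s Al cards0.
have [mx|mx] := leqP 4 #|mixed m f s|.
  exact: (cut_many_mixed c_layer mx).
have [/existsP[i /eqP si]|no_full] := boolP [exists i, s i == m * f].
  exact: (cut_full_empty m_ge3 cardI f1 f2 f3 s_le c_layer e_le c_cross si sl).
apply: (cut_no_full m_ge3 cardI f1 f2 f3 c_layer c_row e_le c_cross _ sl) => //.
  move=> i; rewrite ltn_neqAle s_le andbT.
  by apply: contra no_full => si; apply/existsP; exists i.
by rewrite -sum1_card sum_layers in A4; under eq_bigr do rewrite /s -sum1_card.
Qed.

Lemma cut_no_pure_layer : (forall i, A :&: layer i != set0) ->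
  (forall i, ~: A :&: layer i != set0) -> 8 * m - 12 <= arcs A (~: A).
Proof.
move=> meet_A meet_Ac; rewrite cut_layers.
apply: (cut_many_mixed layer_cut_bound).
have -> : mixed m f s = [set: 'I_m.+1].
  apply/setP => i; rewrite !inE -fact_layer -(card_layer i).
  rewrite -(cardsID A (layer i)) [layer i :&: A]setIC /s card_gt0 meet_A /=.
  by rewrite -[X in X < _]addn0 ltn_add2l card_gt0 setDE setIC meet_Ac.
by rewrite cardsT card_ord.
Qed.

End Step.

Theorem BS_cut m (A : {set BS m}) : 3 <= m -> 4 <= #|A| -> 4 <= #|~: A| ->
  8 * m - 20 <= arcs A (~: A).
Proof.
move=> m3; elim: m m3 A => // m IHm; rewrite leq_eqVlt => /predU1P[m2|m_ge3] A A4 Ac4.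
  (* [BS 3] has six vertices, too few for two sides of four: the base case is vacuous. *)
  have := cardsC A; rewrite card_BS; move: A A4 Ac4; rewrite -m2 => A.
  by rewrite (_ : 3`! = 6) //; lia.
have -> : 8 * m.+1 - 20 = 8 * m - 12 by lia.
have [/existsP[l /eqP Al]|full] := boolP [exists l, A :&: layer l == set0].
  exact: (BS_cut_empty_layer m_ge3 (IHm m_ge3) Al A4).
(* A full layer of [A] is an empty layer of the complement, which has the same cut. *)
have [/existsP[l /eqP Al]|empty] := boolP [exists l, ~: A :&: layer l == set0].
  rewrite -arcs_setC; exact: (BS_cut_empty_layer m_ge3 (IHm m_ge3) Al Ac4).
apply: (cut_no_pure_layer m_ge3 (IHm m_ge3)) => i; [move: full | move: empty];
  by move/existsPn/(_ i).
Qed.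

(** * Fault tolerance up to 6n - 17 deleted edges *)

Lemma BS_conditional_SMEC n : 4 <= n ->
  conditional_edge_fault_tolerant_SMEC (6 * n - 17) (BS n).
Proof.
move=> n4 F _ F_le deg2 u v uv; apply: edge_Menger uv _ => A uA vA.
have {}deg2 (x : del_edges F) : 2 <= deg x.
  have card2 : 2 <= #|del_edges F|.
    have := fact_geq n; rewrite -card_BS; apply: leq_trans; exact: leq_trans n4.
  by have [+ _] := leq_min_deg card2; apply.
have col := @del_2coloring (BS n) F _ (@BS_2coloring n).
rewrite -/(@arcs (del_edges F) A (~: A)).
have [A3|A4] := leqP #|A| 3.
  by rewrite geq_min (deg_le_small_cut col deg2 uA A3).
have [Ac3|Ac4] := leqP #|~: A| 3.
  have vAc : v \in ~: A by rewrite inE.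
  rewrite geq_min -[X in _ || (_ <= X)]arcs_setC.
  by rewrite (deg_le_small_cut col deg2 vAc Ac3) orbT.
(* At least (8n - 20) - (6n - 17) = 2n - 3 edges survive, and [u] has degree at most 2n - 3. *)
have := BS_cut (ltnW n4) A4 Ac4; rewrite (arcs_del F).
have := card_cut_in F A; have := deg_del_le u; rewrite deg_BS; last by lia.
move=> du cutF cut; rewrite geq_min; apply/orP; left; apply: leq_trans du _.
by rewrite -(leq_add2r #|cut_in F A|); apply: leq_trans cut; lia.
Qed.

(** * Sharpness of the bound *)

Lemma subset_of_card (T : finType) (A : {set T}) m :
  m <= #|A| -> exists2 B : {set T}, B \subset A & #|B| = m.
Proof.
rewrite cardE => mA; exists [set x in take m (enum A)].
  by apply/subsetP => x; rewrite inE => /mem_take; rewrite mem_enum.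
rewrite cardsE (card_uniqP _) ?size_takel //; exact/take_uniq/enum_uniq.
Qed.

Section Sharpness.
Variable k : nat.
Let n := k.+4.

(** Two disjoint admissible swaps commute, so 1, [c], [c * d] and [d] form the 4-cycle [X]; the
    identity is the vertex that keeps its full degree. *)
Let c : BS n := tperm (inord 0) (inord 1).
Let d : BS n := tperm (inord 2) (inord 3).

Let inord_neq a b : a < 4 -> b < 4 -> a != b -> inord a != inord b :> 'I_n.
Proof. by move=> a4 b4 ab; rewrite -val_eqE /= !inordK //; lia. Qed.

Let c_odd : odd_perm c.
Proof. by rewrite odd_tperm inord_neq. Qed.

Let d_odd : odd_perm d.
Proof. by rewrite odd_tperm inord_neq. Qed.

Let c_neq_d : c != d.
Proof.
apply/eqP => /permP/(_ (inord 0)); rewrite tpermL tpermD ?inord_neq //.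
by apply/eqP/inord_neq.
Qed.

Let cdC : (c * d = d * c)%g.
Proof.
apply/commgP/conjg_fixP.
by rewrite tpermJ /d !tpermD // inord_neq.
Qed.

Let X : {set BS n} := [set x in [:: 1; c; d; c * d]%g].

Let c2 : (c * c = 1)%g. Proof. exact: tperm2. Qed.
Let d2 : (d * d = 1)%g. Proof. exact: tperm2. Qed.

Let cd_neq1 : (c * d != 1)%g.
Proof. by rewrite -c2 (inj_eq (mulgI c)) eq_sym. Qed.

Let card_X : #|X| = 4.
Proof.
have neq x y : odd_perm x != odd_perm y -> (x == y) = false.
  by move=> neq; apply: contraNF neq => /eqP ->.
rewrite cardsE; apply/eqP; rewrite (card_uniqP _) //= !inE.
rewrite (negPf c_neq_d) [1%g == (c * d)%g]eq_sym (negPf cd_neq1).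
by rewrite !neq ?odd_permM ?c_odd ?d_odd ?odd_perm1.
Qed.

Let nbr_X x := [set y in X | adj x y].

(** Adjacent permutations have opposite parity, and [X] has two vertices of each parity. *)
Let card_nbr_X_le x : #|nbr_X x| <= 2.
Proof.
have [y1 [y2 sub]] : exists y1 y2, nbr_X x \subset [set y1; y2].
  exists (if odd_perm x then 1 else c)%g, (if odd_perm x then c * d else d)%g.
  apply/subsetP => y; rewrite !inE => /andP[+ /BS_2coloring].
  case/or4P => /eqP->; rewrite ?odd_permM ?c_odd ?d_odd ?odd_perm1 //;
  by case: odd_perm => //; rewrite eqxx ?orbT.
by apply: leq_trans (subset_leq_card sub) _; rewrite cards2; case: eqP.
Qed.

Let square_nbrs x : x \in X ->
  [/\ (c * x)%g \in nbr_X x, (d * x)%g \in nbr_X x & (c * x != d * x)%g].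
Proof.
move=> xX; rewrite (inj_eq (mulIg x)) c_neq_d.
have c_adj : @adj (BS n) x (c * x)%g.
  by apply/bs_adjP; exists (inord 0, inord 1); rewrite // /bs_swap /= !inordK.
have d_adj : @adj (BS n) x (d * x)%g.
  by apply/bs_adjP; exists (inord 2, inord 3); rewrite // /bs_swap /= !inordK.
rewrite !inE c_adj d_adj !andbT; move: xX; rewrite !inE.
case/or4P => /eqP->; rewrite ?mulg1 ?eqxx ?orbT; split=> //.
- by rewrite c2 eqxx.
- by rewrite cdC eqxx !orbT.
- by rewrite d2 eqxx.
- by rewrite mulgA c2 mul1g eqxx !orbT.
- by rewrite cdC mulgA d2 mul1g eqxx !orbT.
Qed.

Let card_nbr_X x : x \in X -> #|nbr_X x| = 2.
Proof.
move=> /square_nbrs[cx dx neq]; apply/eqP; rewrite eqn_leq card_nbr_X_le.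
have <- : #|[set (c * x)%g; (d * x)%g]| = 2 by rewrite cards2 neq.
by apply: subset_leq_card; rewrite subUset !sub1set cx.
Qed.

Let crossing := [set z in setX X (~: X) | @adj (BS n) z.1 z.2].

Let card_crossing : #|crossing| = 8 * n - 20.
Proof.
rewrite -arcs_card; have := arcs_deg X.
rewrite (eq_bigr (fun=> 2 * n - 3)) => [|x _]; last exact: deg_BS.
have -> : arcs X X = 8.
  rewrite /arcs (eq_bigr (fun=> 2)) => [|x xX]; last by rewrite sum_card_pred card_nbr_X.
  by rewrite sum_nat_const card_X.
rewrite sum_nat_const card_X; lia.
Qed.

(** At most (2n - 3) - 2 of the 8n - 20 crossing pairs start at the identity, so at least 6n - 15
    others remain. *)
Let enough_crossing : 6 * n - 16 <= #|[set z in crossing | z.1 != 1%g :> BS n]|.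
Proof.
have -> : [set z in crossing | z.1 != 1%g :> BS n] =
    crossing :\: [set z | z.1 == 1%g :> BS n].
  by apply/setP => z; rewrite !inE andbC.
have : #|crossing :&: [set z | z.1 == 1%g :> BS n]| <= 2 * n - 5.
  have X1 : (1%g : BS n) \in X by rewrite inE mem_head.
  have <- : #|[set y | @adj (BS n) 1%g y] :\: X| = 2 * n - 5.
    have := card_nbr_X X1; rewrite /nbr_X setIdE setIC => nbr1.
    have := deg_BS (1%g : BS n) isT; rewrite /deg -(cardsID X) nbr1.
    by move: #|_ :\: _| => a; lia.
  rewrite -[X in _ <= X](card_imset _ (f := pair (1%g : BS n))); last by move=> y z [].
  apply: subset_leq_card; apply/subsetP => -[x y]; rewrite !inE /=.
  case/andP=> /andP[/andP[_ yX] xy] /eqP ex; rewrite ex in xy *.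
  by apply: imset_f; rewrite !inE xy andbT.
by have := cardsID [set z | z.1 == 1%g :> BS n] crossing; rewrite card_crossing; lia.
Qed.

Lemma BS_sharp : exists F : {set {set BS n}},
  [/\ F \subset edges (BS n), #|F| = 6 * n - 16, 2 <= min_deg (del_edges F)
    & ~ strongly_Menger_edge_connected (del_edges F)].
Proof.
have [Z /subsetP ZC cardZ] := subset_of_card enough_crossing.
have Z_cross x y : (x, y) \in Z -> [/\ x \in X, y \notin X, @adj (BS n) x y & x != 1%g].
  by move/ZC; rewrite !inE /= -!andbA => /and4P[-> -> -> ->].
pose F := [set [set z.1; z.2] | z in Z] : {set {set BS n}}.
have FE x y : ([set x; y] \in F) = ((x, y) \in Z) || ((y, x) \in Z).
  apply/imsetP/orP => [[[a b] abZ /= /set2_inj[][-> ->]]|[]]; [by left|by right| |].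
    by exists (x, y).
  by exists (y, x); rewrite //= setUC.
have cardF : #|F| = 6 * n - 16.
  rewrite card_in_imset // => z t /ZC + /ZC +; rewrite !inE -!andbA.
  move=> /and3P[z1 z2 _] /and3P[t1 t2 _]; apply: (@pair_set_inj _ X); rewrite !inE.
    by rewrite z1 z2.
  by rewrite t1 t2.
have F_edges : F \subset edges (BS n).
  apply/subsetP => _ /imsetP[[x y] /Z_cross[_ _ xy _] ->].
  by apply/imsetP; exists (x, y); rewrite ?inE.
have del_adjE x y : @adj (del_edges F) x y =
    [&& @adj (BS n) x y, (x, y) \notin Z & (y, x) \notin Z].
  by rewrite -negb_or -FE.
have deg_inside (x : del_edges F) : x \in X -> 2 <= deg x.
  move=> xX; have [cx dx neq] := square_nbrs xX.
  have <- : #|[set (c * x)%g; (d * x)%g]| = 2 by rewrite cards2 neq.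
  apply: subset_leq_card; apply/subsetP => y /set2P y_eq.
  have : y \in nbr_X x by case: y_eq => ->.
  rewrite in_set => /andP[yX xy]; rewrite in_set del_adjE xy /=.
  by apply/andP; split; apply/negP => /Z_cross[]; rewrite ?yX ?xX.
(* Such a vertex loses only edges to [X], at most two of its 2n - 3 >= 5 edges. *)
have deg_outside (x : del_edges F) : x \notin X -> 2 <= deg x.
  move=> xX; have := deg_BS (x : BS n) isT; rewrite /deg -(cardsID X).
  have := card_nbr_X_le x; rewrite /nbr_X setIdE setIC => nbr_x deg_x.
  apply: (@leq_trans #|[set y | @adj (BS n) x y] :\: X|).
    by move: nbr_x deg_x; move: #|_ :&: _| #|_ :\: _| => a b; lia.
  apply: subset_leq_card; apply/subsetP => y; rewrite in_setD in_set => /andP[yX xy].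
  rewrite in_set del_adjE xy /=.
  by apply/andP; split; apply/negP => /Z_cross[]; rewrite ?(negPf yX) ?(negPf xX).
exists F; split=> //.
  have card2 : 2 <= #|del_edges F|.
    by have := fact_geq n; rewrite -card_BS; apply: leq_trans.
  apply/(leq_min_deg card2) => x.
  by have [/deg_inside|/deg_outside] := boolP (x \in X).
have full_deg (x : del_edges F) : (forall y, (x, y) \notin Z) ->
    (forall y, (y, x) \notin Z) -> deg x = 2 * n - 3.
  move=> out_x in_x; rewrite -(deg_BS (x : BS n) isT); apply: eq_card => y.
  by rewrite !in_set del_adjE out_x in_x !andbT.
(* A second endpoint of full degree: [X] and the outer ends of [Z] cover at most 4 + (6n - 16)
   vertices, while n! >= 6n. *)
have [v] : exists v, v \notin X :|: [set z.2 | z in Z].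
  apply/existsP; rewrite -negb_forall; apply/negP => /forallP all_in.
  have : #|BS n| <= #|X| + #|[set z.2 | z in Z]|.
    apply: leq_trans (leq_card_setU _ _); apply: subset_leq_card.
    by apply/subsetP => x _; apply: all_in.
  rewrite card_BS card_X => le.
  have := leq_trans le (leq_add (leqnn 4) (leq_imset_card snd Z)).
  have fact3 : 3`! <= k.+3`! by rewrite leq_fact.
  have : k.+4 * 6 <= n`! by rewrite factS leq_mul2l fact3.
  by rewrite cardZ; move: n`! => N; rewrite /n; lia.
rewrite in_setU negb_or => /andP[vX v_touch] SMEC.
have deg1 : @deg (del_edges F) 1%g = 2 * n - 3.
  apply: full_deg => y; apply/negP => /Z_cross[]; first by rewrite eqxx.
  by rewrite [1%g \in _]in_set mem_head.
have degv : @deg (del_edges F) v = 2 * n - 3.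
  apply: full_deg => y; apply/negP; first by case/Z_cross; rewrite (negPf vX).
  by move=> yvZ; case/imsetP: v_touch; exists (y, v).
have v1 : (1%g : del_edges F) != v.
  by apply: contraNneq vX => <-; rewrite in_set mem_head.
have [ps [ps_path ps_disj]] := SMEC _ _ v1.
have := @disjoint_paths_cut (del_edges F) _ ps X _ _ ps_path ps_disj.
rewrite deg1 degv minnn [1%g \in _]in_set mem_head => /(_ isT vX).
have cutZ : #|cut_in F X| = 6 * n - 16.
  rewrite -cardZ; apply: eq_card => -[x y].
  rewrite in_set in_setX in_setC [in _ \in F]/= FE; apply/idP/idP => [|xyZ].
    case/and3P=> /andP[/= xX yX] _ /orP[//|/Z_cross[yX' _ _ _]].
    by rewrite yX' in yX.
  by have [xX yX xy _] := Z_cross _ _ xyZ; apply/and3P; split; rewrite //= ?xX ?xyZ.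
(* Only (8n - 20) - (6n - 16) = 2n - 4 edges still leave [X], one fewer than 2n - 3 disjoint paths
   need. *)
have := arcs_del F X; rewrite arcs_card card_crossing cutZ => eq_cut.
by rewrite -(leq_add2r (6 * n - 16)) -eq_cut; lia.
Qed.


End Sharpness.

Theorem theorem4p1 (n : nat) (hn : 4 <= n) :
  conditional_edge_fault_tolerant_SMEC (6 * n - 17) (BS n) /\
  exists F : {set {set BS n}},
    [/\ F \subset edges (BS n),
        #|F| = 6 * n - 16,
        2 <= min_deg (del_edges F)
      & ~ strongly_Menger_edge_connected (del_edges F)].
Proof.
split; first exact: BS_conditional_SMEC.
case: n hn => [|[|[|[|k]]]] // _; exact: BS_sharp.
Qed.
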